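(* Let $n,k,l$ be integers with $k>0$, $l>\frac n2$ and $k+l<n$. Suppose that \[ \Bigl(1+\frac{n-k}{n-1}\Bigr)\frac{l-1}{n-1}<1 \quad\text{and}\quad (n-k)\sum_{i=n-l}^{n-2}\frac1i-(n-l)\sum_{i=k}^{n-2}\frac1i<0 . \] Then $M(n,k,l)=\binom{n-1}{k-1}\binom{n-1}{l-1}$. Moreover, if $\mathcal{A}\subset\binom{[n]}{k}$ and $\mathcal{B}\subset\binom{[n]}{l}$ are cross-intersecting families with $|\mathcal{A}||\mathcal{B}|=M(n,k,l)$, then there is $i\in[n]$ such that $\mathcal{A}=\{A\in\binom{[n]}{k}:i\in A\}$ and $\mathcal{B}=\{B\in\binom{[n]}{l}:i\in B\}$.
   Context: $[n]=\{1,\dots,n\}$ and $\binom{[n]}{k}$ is the set of $k$-element subsets of $[n]$. Families $\mathcal{A},\mathcal{B}$ are cross-intersecting if $A\cap B\ne\emptyset$ for all $A\in\mathcal{A},B\in\mathcal{B}$. $M(n,k,l)$ denotes the maximum of $|\mathcal{A}||\mathcal{B}|$ over cross-intersecting families $\mathcal{A}\subset\binom{[n]}{k}$, $\mathcal{B}\subset\binom{[n]}{l}$. *)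

(* Defs.v *)
From mathcomp Require Import all_boot all_order all_algebra.

Set Implicit Arguments.
Unset Strict Implicit.
Unset Printing Implicit Defensive.

(* The ground set [n] = {1, ..., n} is represented by 'I_n. *)

Definition ksets (n k : nat) : {set {set 'I_n}} :=
  [set A : {set 'I_n} | #|A| == k].

Definition cross_intersecting (n : nat) (F G : {set {set 'I_n}}) : bool :=
  [forall A in F, forall B in G, A :&: B != set0].

(* The index set is never empty: (set0, set0) satisfies the side conditions,
   so this is a genuine maximum. *)
Definition M (n k l : nat) : nat :=
  \max_(FG : {set {set 'I_n}} * {set {set 'I_n}}
        | [&& FG.1 \subset ksets n k, FG.2 \subset ksets n l
            & cross_intersecting FG.1 FG.2])
    (#|FG.1| * #|FG.2|).

(* Main.v *)
Require Import Defs.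
From mathcomp Require Import all_boot all_order all_fingroup all_algebra.
From mathcomp Require Import zify ring lra realalg.
Set Implicit Arguments.
Unset Strict Implicit.
Unset Printing Implicit Defensive.
Import Order.TTheory GRing.Theory Num.Theory.

(* Passing to complements, let [F] be the family of complements of the members
   of [A] and [G] the [l]-sets outside [B]: then [G] contains every [l]-subset
   of a member of [F], so lower bounds on shadows bound [#|B|] in terms of
   [#|A|]. Put [P = 'C(n-1, k-1)] and [Q = 'C(n-1, l-1)].
   - If [#|B| >= Q], then [#|G| <= 'C(n-1, l)], and Keevash's vertex-averaging
     proof of the Kruskal-Katona theorem gives
     [#|F| / 'C(n-1, n-k) <= #|G| / 'C(n-1, l)], with equality only if [G] is
     complete on [n-1] points; since ['C(n-1, l) < Q] this bounds the product
     and characterises equality.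
   - If [#|A| = P + 'C(x, n-k-1)] with [x <= n-2] real, the two-term
     Kruskal-Katona bound gives [#|B| <= Q - 'C(x, l-1)]. That the product is
     less than [P * Q] is the first hypothesis at [x = n-2], and the second one
     propagates it to all smaller [x].
   - Otherwise [#|B| <= 'C(n-2, l-2)]; writing [#|B| = 'C(y, n-l)], Lovasz's
     bound gives [#|A| <= 'C(n, k) - 'C(y, k)], and the product is largest at
     [y = n-2], where it is again below [P * Q] by the first hypothesis. *)

(** * Uniform families, links and shadows *)

Definition draws (T : finType) (V : {set T}) (r : nat) : {set {set T}} :=
  [set X : {set T} | X \subset V & #|X| == r].

Definition link (T : finType) (v : T) (F : {set {set T}}) : {set {set T}} :=
  [set X : {set T} | (v \notin X) && (v |: X \in F)].

Definition avoid (T : finType) (v : T) (F : {set {set T}}) : {set {set T}} :=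
  [set X in F | v \notin X].

Definition shadow (T : finType) (F : {set {set T}}) : {set {set T}} :=
  [set Y : {set T} | [exists z, Y \in link z F]].

Lemma shadowP (T : finType) (F : {set {set T}}) (Y : {set T}) :
  reflect (exists2 z, z \notin Y & z |: Y \in F) (Y \in shadow F).
Proof.
rewrite inE; apply: (iffP existsP) => [[z]|[z zY zF]].
  by rewrite inE => /andP[]; exists z.
by exists z; rewrite inE zY.
Qed.

Arguments shadowP {T F Y}.

Lemma drawsP (T : finType) (V : {set T}) (r : nat) (X : {set T}) :
  reflect (X \subset V /\ #|X| = r) (X \in draws V r).
Proof. by rewrite inE; apply: (iffP andP) => -[-> /eqP]. Qed.

Arguments drawsP {T V r X}.

Lemma card_link (T : finType) (v : T) (F : {set {set T}}) :
  #|link v F| = #|[set X in F | v \in X]|.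
Proof.
have inj : {in link v F &, injective (fun X => v |: X)}.
  move=> X Y; rewrite !inE => /andP[vX _] /andP[vY _] eqXY.
  by rewrite -(setU1K vX) -(setU1K vY) eqXY.
rewrite -(card_in_imset inj); apply: eq_card => X.
apply/imsetP/idP => [[Y]|]; rewrite !inE.
  by case/andP=> vY YF ->; rewrite YF setU11.
case/andP=> XF vX; exists (X :\ v); last by rewrite setD1K.
by rewrite inE setD11 setD1K.
Qed.

Lemma card_link_avoid (T : finType) (v : T) (F : {set {set T}}) :
  #|F| = #|link v F| + #|avoid v F|.
Proof.
rewrite card_link -(cardsID [set X : {set T} | v \in X] F); congr (_ + _).
  by apply: eq_card => X; rewrite !inE.
by apply: eq_card => X; rewrite !inE andbC.
Qed.

(** Double counting of the incidences [v \in X]. *)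
Lemma sum_link (T : finType) (V : {set T}) (r : nat) (F : {set {set T}}) :
  F \subset draws V r -> \sum_v #|link v F| = r * #|F|.
Proof.
move=> /subsetP FV; under eq_bigr do rewrite card_link -sum1dep_card.
under eq_bigr do rewrite big_mkcondr.
rewrite exchange_big /= mulnC -sum_nat_const.
apply: eq_bigr => X /FV/drawsP[_ <-].
by rewrite -big_mkcond sum1_card.
Qed.

Lemma link_draws (T : finType) (v : T) (V : {set T}) (r : nat)
    (F : {set {set T}}) :
  F \subset draws V r.+1 -> link v F \subset draws (V :\ v) r.
Proof.
move=> /subsetP FV; apply/subsetP => X; rewrite inE => /andP[vX /FV/drawsP[sXV]].
rewrite cardsU1 vX => -[cX]; apply/drawsP; split=> //.
by rewrite subsetD1 vX (subset_trans _ sXV) // subsetUr.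
Qed.

Lemma avoid_draws (T : finType) (v : T) (V : {set T}) (r : nat)
    (F : {set {set T}}) :
  F \subset draws V r -> avoid v F \subset draws (V :\ v) r.
Proof.
move=> /subsetP FV; apply/subsetP => X; rewrite inE => /andP[/FV/drawsP[sXV cX] vX].
by apply/drawsP; split=> //; rewrite subsetD1 sXV.
Qed.

Lemma shadow_draws (T : finType) (V : {set T}) (r : nat) (F : {set {set T}}) :
  F \subset draws V r.+1 -> shadow F \subset draws V r.
Proof.
move=> FV; apply/subsetP => Y; rewrite inE => /existsP[z].
move/(subsetP (link_draws z FV))/drawsP => [sY cY]; apply/drawsP; split=> //.
exact: subset_trans sY (subD1set _ _).
Qed.

Lemma mem_linkP (T : finType) (v : T) (F : {set {set T}}) (X : {set T}) :
  reflect (v \notin X /\ v |: X \in F) (X \in link v F).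
Proof. by rewrite inE; apply: andP. Qed.
Arguments mem_linkP {T v F X}.

Lemma link_shadow (T : finType) (v : T) (F : {set {set T}}) :
  shadow (link v F) \subset link v (shadow F).
Proof.
apply/subsetP => X /shadowP[z zX]; case/mem_linkP.
rewrite !in_setU1 negb_or => /andP[vz vX] F_vzX; apply/mem_linkP; split=> //.
by apply/shadowP; exists z; rewrite ?[z |: (v |: X)]setUCA // !inE negb_or zX eq_sym vz.
Qed.

Lemma link_sub_shadow (T : finType) (v : T) (F : {set {set T}}) :
  link v F \subset avoid v (shadow F).
Proof.
apply/subsetP => X /mem_linkP[vX vXF]; rewrite inE vX andbT.
by apply/shadowP; exists v.
Qed.

Lemma linkS (T : finType) (v : T) (F G : {set {set T}}) :
  F \subset G -> link v F \subset link v G.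
Proof.
by move=> /subsetP FG; apply/subsetP => X /mem_linkP[? /FG ?]; apply/mem_linkP.
Qed.

Lemma avoidS (T : finType) (v : T) (F G : {set {set T}}) :
  F \subset G -> avoid v F \subset avoid v G.
Proof.
by move=> /subsetP FG; apply/subsetP => X; rewrite !inE => /andP[/FG -> ->].
Qed.

Lemma card_draws (T : finType) (V : {set T}) (r : nat) :
  #|draws V r| = 'C(#|V|, r).
Proof. exact: cards_draws. Qed.

Lemma drawsS (T : finType) (V W : {set T}) (r : nat) :
  V \subset W -> draws V r \subset draws W r.
Proof.
move=> VW; apply/subsetP => X /drawsP[XV cX].
by apply/drawsP; split=> //; apply: subset_trans XV VW.
Qed.

Lemma shadow_eq0 (T : finType) (V : {set T}) (r : nat) (F : {set {set T}}) :
  F \subset draws V r.+1 -> shadow F = set0 -> F = set0.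
Proof.
move=> /subsetP FV F0; apply/eqP/set0Pn => -[X XF].
have /drawsP[_ cX] := FV X XF.
have /card_gt0P[z zX] : 0 < #|X| by rewrite cX.
suff : X :\ z \in shadow F by rewrite F0 inE.
by apply/shadowP; exists z; rewrite ?setD11 // setD1K.
Qed.

(** * Keevash's vertex-averaging bound on cliques *)

(** Summing the vertex bounds double counts both sides, and the common factor [r.+1] cancels. In
    case of equality every vertex bound is tight, so all vertices of positive degree have degree
    ['C(a, r)]; there are then [a.+1] of them, and [G] consists of all [r.+1]-subsets of this
    set. *)
Lemma clique_count_of_links (T : finType) (a r : nat) (G H : {set {set T}}) :
  r <= a -> G \subset draws setT r.+1 -> H \subset draws setT r.+2 ->
  #|G| <= 'C(a.+1, r.+1) ->
  (forall v, r.+1 * #|link v H| <= (a - r) * #|link v G| /\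
     (r.+1 * #|link v H| = (a - r) * #|link v G| -> 0 < #|link v G| ->
      #|link v G| = 'C(a, r) /\ #|G| = 'C(a.+1, r.+1))) ->
  r.+2 * #|H| <= (a - r) * #|G| /\
  (r.+2 * #|H| = (a - r) * #|G| -> G != set0 ->
   exists2 Y : {set T}, #|Y| = a.+1 & G = draws Y r.+1).
Proof.
move=> ra GV HV cG pw.
have sumG := sum_link GV; have sumH := sum_link HV.
have le_sum : \sum_v r.+1 * #|link v H| <= \sum_v (a - r) * #|link v G|.
  by apply: leq_sum => v _; case: (pw v).
have lhsE : \sum_v r.+1 * #|link v H| = r.+1 * (r.+2 * #|H|).
  by rewrite -big_distrr sumH.
have rhsE : \sum_v (a - r) * #|link v G| = r.+1 * ((a - r) * #|G|).
  by rewrite -big_distrr sumG /= mulnCA.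
split=> [|eqHG /set0Pn[X0 X0G]].
  by move: le_sum; rewrite lhsE rhsE leq_pmul2l.
have eq_pw v : r.+1 * #|link v H| = (a - r) * #|link v G|.
  apply/eqP; rewrite eqn_leq (proj1 (pw v)) leqNgt; apply/negP => lt_v.
  have : \sum_v r.+1 * #|link v H| < \sum_v (a - r) * #|link v G|.
    rewrite (bigD1 v) //= [X in _ < X](bigD1 v) //= -addSn leq_add //.
    by apply: leq_sum => w _; case: (pw w).
  by rewrite lhsE rhsE eqHG ltnn.
pose Y := [set v | 0 < #|link v G|].
have degY v : v \in Y -> #|link v G| = 'C(a, r) /\ #|G| = 'C(a.+1, r.+1).
  by rewrite inE => dv; apply: (proj2 (pw v)).
have inY v X : X \in G -> v \in X -> v \in Y.
  move=> XG vX; rewrite inE; apply/card_gt0P; exists (X :\ v).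
  by apply/mem_linkP; rewrite setD11 setD1K.
have cGE : #|G| = 'C(a.+1, r.+1).
  have /drawsP[_ cX0] := subsetP GV X0 X0G.
  have /card_gt0P[v vX0] : 0 < #|X0| by rewrite cX0.
  by case: (degY v (inY v X0 X0G vX0)).
have cY : #|Y| = a.+1.
  have : \sum_v #|link v G| = #|Y| * 'C(a, r).
    rewrite (bigID (mem Y)) /= [X in _ + X]big1 ?addn0 => [|v]; last first.
      by rewrite inE -eqn0Ngt => /eqP.
    by rewrite -sum_nat_const; apply: eq_bigr => v /degY[].
  rewrite sumG cGE -mul_bin_diag /= => /eqP; rewrite eqn_pmul2r ?bin_gt0 //.
  by move/eqP.
exists Y => //; apply/eqP; rewrite eqEcard card_draws cY cGE leqnn andbT.
apply/subsetP => X XG; have /drawsP[_ cX] := subsetP GV X XG.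
by apply/drawsP; split=> //; apply/subsetP => v; apply: inY.
Qed.

(** The case of a vertex of large degree [d], where [f] counts the sets of [G] avoiding it and [h]
    is its degree in [H]: [r.+1 * h <= r.+1 * (g - d)], which is at most
    [a.+1 * 'C(a, r) - r.+1 * d] and hence at most [(a - r) * d]. *)
Lemma link_degree_arith (a r g d f h : nat) :
  r <= a -> 'C(a, r) <= d -> g <= 'C(a.+1, r.+1) -> h <= f -> g = d + f ->
  r.+1 * h <= (a - r) * d /\
  (r.+1 * h = (a - r) * d -> 0 < d -> d = 'C(a, r) /\ g = 'C(a.+1, r.+1)).
Proof.
move=> ra le_d le_g le_h gE; rewrite gE in le_g *; have binE := mul_bin_diag a.+1 r.
have -> : a - r = a.+1 - r.+1 by lia.
rewrite /= in binE; rewrite mulnBl.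
have g_le : r.+1 * (d + f) <= a.+1 * 'C(a, r).
  by rewrite binE leq_mul2l le_g.
have d_le : a.+1 * 'C(a, r) <= a.+1 * d by rewrite leq_mul2l le_d.
have h_le : r.+1 * h <= r.+1 * f by rewrite leq_mul2l le_h.
rewrite mulnDr in g_le.
split=> [|eq_h _]; first lia.
have /eqP : a.+1 * d = a.+1 * 'C(a, r) by lia.
rewrite eqn_pmul2l // => /eqP dE; split=> //.
apply/eqP; rewrite -(eqn_pmul2l (ltn0Sn r)) -binE mulnDr; lia.
Qed.

(* Keevash's argument: for each vertex [v], the link of [H] at [v] is bounded
   both by [#|G|] minus the degree of [v] in [G] and, inductively, by the link
   of [G]; averaging over [v] gives the bound. *)
Lemma clique_count (T : finType) (a r : nat) (G H : {set {set T}}) :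
  r <= a -> G \subset draws setT r.+1 -> H \subset draws setT r.+2 ->
  shadow H \subset G -> #|G| <= 'C(a.+1, r.+1) ->
  r.+2 * #|H| <= (a - r) * #|G| /\
  (r.+2 * #|H| = (a - r) * #|G| -> G != set0 ->
   exists2 Y : {set T}, #|Y| = a.+1 & G = draws Y r.+1).
Proof.
elim: r a G H => [|r IHr] a G H ra GV HV sHG cG;
  apply: clique_count_of_links => // v.
all: have lHG : shadow (link v H) \subset link v G
  by exact: subset_trans (link_shadow v H) (linkS v sHG).
all: have lHV := subset_trans (link_draws v HV) (drawsS _ (subsetT _)).
all: have lGV := subset_trans (link_draws v GV) (drawsS _ (subsetT _)).
all: have h_le : #|link v H| <= #|avoid v G|
  by apply: subset_leq_card;
     apply: subset_trans (link_sub_shadow v H) (avoidS v sHG).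
all: have cGE := card_link_avoid v G.
  have [d0|d_gt0] := posnP #|link v G|.
    have /(shadow_eq0 lHV) H0 : shadow (link v H) = set0.
      by apply/eqP; rewrite -subset0 -(cards0_eq d0).
    by rewrite d0 H0 cards0 !muln0.
  have := link_degree_arith ra _ cG h_le cGE; rewrite bin0.
  by case/(_ d_gt0) => le_h eq_h; split=> // /eq_h /(_ d_gt0).
(* A vertex of smaller positive degree is never tight: equality in the inductive bound would make
   its link complete on [a] points and so give it degree ['C(a, r.+1)]. *)
have [le_d|lt_d] := leqP 'C(a, r.+1) #|link v G|.
  exact: link_degree_arith cG h_le cGE.
case: a => // a in ra cG lt_d *.
have [le_h eq_h] := IHr a _ _ ra lGV lHV lHG (ltnW lt_d).
split=> // /eq_h eqd d_gt0; exfalso.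
have [|Y cY lGE] := eqd; first by rewrite -card_gt0.
by move: lt_d; rewrite lGE card_draws cY ltnn.
Qed.

(** * Shifting *)

Definition swap (T : finType) (e j : T) (X : {set T}) : {set T} :=
  [set w | tperm e j w \in X].

(* [swap e j X] replaces [j] by [e] in a set [X] that contains only [j];
   [compress] is the usual down-shift towards [e]. *)
Definition compress (T : finType) (e j : T) (F : {set {set T}}) : {set {set T}} :=
  [set X : {set T} | if (e \in X) == (j \in X) then X \in F
    else if e \in X then (X \in F) || (swap e j X \in F)
    else (X \in F) && (swap e j X \in F)].

Lemma swapK (T : finType) (e j : T) : involutive (swap e j).
Proof. by move=> X; apply/setP => w; rewrite !inE tpermK. Qed.

Lemma card_swap (T : finType) (e j : T) (X : {set T}) : #|swap e j X| = #|X|.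
Proof.
rewrite -(card_imset X (@perm_inj _ (tperm e j))); apply: eq_card => w.
rewrite inE; apply/idP/imsetP => [wX|[u uX ->]]; last by rewrite tpermK.
by exists (tperm e j w); rewrite ?tpermK.
Qed.

Lemma swap_id (T : finType) (e j : T) (X : {set T}) :
  (e \in X) = (j \in X) -> swap e j X = X.
Proof. by move=> ejX; apply/setP => w; rewrite inE; case: tpermP => [->|->|]. Qed.

Lemma swap_setU1 (T : finType) (e j z : T) (X : {set T}) :
  swap e j (z |: X) = tperm e j z |: swap e j X.
Proof.
by apply/setP => w; rewrite !inE (can2_eq (tpermK e j) (tpermK e j)).
Qed.

Lemma mem_swapL (T : finType) (e j : T) (X : {set T}) :
  (e \in swap e j X) = (j \in X).
Proof. by rewrite inE tpermL. Qed.

Lemma mem_swapR (T : finType) (e j : T) (X : {set T}) :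
  (j \in swap e j X) = (e \in X).
Proof. by rewrite inE tpermR. Qed.

Lemma swap_draws (T : finType) (V : {set T}) (r : nat) (e j : T) (X : {set T}) :
  e \in V -> j \in V -> X \in draws V r -> swap e j X \in draws V r.
Proof.
move=> eV jV /drawsP[/subsetP XV cX]; apply/drawsP; rewrite card_swap.
by split=> //; apply/subsetP => w; rewrite inE; case: tpermP => [->|->|_ _ /XV].
Qed.

Lemma compress_draws (T : finType) (V : {set T}) (r : nat) (e j : T)
    (F : {set {set T}}) :
  e \in V -> j \in V -> F \subset draws V r -> compress e j F \subset draws V r.
Proof.
move=> eV jV /subsetP FV; apply/subsetP => X; rewrite inE.
case: ifP => _; first exact: FV.
case: ifP => _; last by case/andP=> /FV.
by case/orP=> /FV // /(swap_draws eV jV); rewrite swapK.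
Qed.

(** The classical shift map [sh], which moves a set with [j] but not [e] unless its swap is already
    present, is injective on [F] with image [compress e j F]. *)
Lemma card_compress (T : finType) (e j : T) (F : {set {set T}}) :
  #|compress e j F| = #|F|.
Proof.
pose sh (X : {set T}) :=
  if [&& j \in X, e \notin X & swap e j X \notin F] then swap e j X else X.
have inj : {in F &, injective sh}.
  move=> X Y XF YF; rewrite /sh.
  case: ifP => [/and3P[_ _ XF']|_]; case: ifP => [/and3P[_ _ YF']|_] //.
  - exact: (inv_inj (swapK e j)).
  - by move=> eqY; rewrite eqY YF in XF'.
  - by move=> eqX; rewrite -eqX XF in YF'.
rewrite -(card_in_imset inj); apply: eq_card => Z; apply/idP/imsetP.
  rewrite inE; case: eqP => [ejZ ZF|ejZ].
    by exists Z => //; rewrite /sh ejZ; case: (j \in Z).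
  case: ifP => eZ.
    have [ZF _|ZF /= sZF] := boolP (Z \in F); first by exists Z; rewrite // /sh eZ andbF.
    exists (swap e j Z) => //; rewrite /sh mem_swapL mem_swapR swapK eZ ZF.
    by case: (j \in Z) ejZ => //; rewrite eZ.
  by case/andP=> ZF sZF; exists Z; rewrite // /sh sZF !andbF.
case=> X XF ->; rewrite /sh; case: ifP => [/and3P[jX eX sXF]|].
  by rewrite inE mem_swapL mem_swapR jX (negPf eX) swapK XF orbT.
rewrite inE XF /=; case: (e \in X); case: (j \in X) => //=.
by move/negbFE.
Qed.

Lemma shadow_compress (T : finType) (e j : T) (F : {set {set T}}) :
  shadow (compress e j F) \subset compress e j (shadow F).
Proof.
have [->|ej] := eqVneq e j.
  have compr_id G : compress j j G = G by apply/setP => X; rewrite inE eqxx.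
  by rewrite !compr_id.
have shI z (Y : {set T}) : z \notin Y -> z |: Y \in F -> Y \in shadow F.
  by move=> zY zYF; apply/shadowP; exists z.
have shS z (Y : {set T}) : z != e -> z != j -> z \notin Y -> swap e j (z |: Y) \in F ->
    swap e j Y \in shadow F.
  move=> ze zj zY; rewrite swap_setU1 tpermD 1?eq_sym // => zYF.
  by apply: shI zYF; rewrite inE tpermD // eq_sym.
apply/subsetP => Y /shadowP[z zY]; rewrite [_ \in compress e j F]inE.
rewrite [Y \in compress _ _ _]inE !in_setU1.
have [ze|ze] := eqVneq z e.
  rewrite ze in zY *; rewrite (negPf zY) [j == e]eq_sym (negPf ej) /=.
  case: (boolP (j \in Y)) => jY /=.
    (* Here [e |: Y] contains both points, so removing [j] from it yields the swap of [Y]. *)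
    move=> eYF; rewrite (shI _ _ zY eYF) /=; apply: (shI j).
      by rewrite mem_swapR.
    have -> : j |: swap e j Y = swap e j (e |: Y) by rewrite swap_setU1 tpermL.
    rewrite swap_id //.
    by rewrite !in_setU1 eqxx jY orbT.
  case/orP=> [/shI-> //|]; rewrite swap_setU1 tpermL swap_id; last first.
    by rewrite (negPf zY) (negPf jY).
  exact: shI.
have [zj|zj] := eqVneq z j.
  rewrite zj in zY *; rewrite (negPf zY) /=.
  case: (boolP (e \in Y)) => eY /=; first by move/shI->.
  by case/andP=> /shI->.
rewrite /=.
case: ifP => _; first exact: shI.
case: ifP => _; first by case/orP=> [/shI-> //|/shS-> //]; rewrite orbT.
by case/andP=> /shI-> // /shS->.
Qed.

(** Rather than iterating compressions, take [F'] of largest degree at [e] among the admissible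
    families. Were some [j |: Y] in [F'] to avoid [e] with [e |: Y] missing, compressing [j] to [e]
    would raise that degree. *)
Lemma exists_shifted (T : finType) (V : {set T}) (r : nat) (e : T)
    (F : {set {set T}}) :
  e \in V -> F \subset draws V r ->
  exists F' : {set {set T}},
    [/\ F' \subset draws V r, #|F'| = #|F|, #|shadow F'| <= #|shadow F| &
     shadow (avoid e F') \subset link e F'].
Proof.
move=> eV FV.
pose P (G : {set {set T}}) :=
  [&& G \subset draws V r, #|G| == #|F| & #|shadow G| <= #|shadow F|].
have PF : P F by rewrite /P FV eqxx leqnn.
have [F' /and3P[F'V /eqP cF' sF'] maxF'] := arg_maxnP (fun G => #|link e G|) PF.
exists F'; split=> //; apply/subsetP => Y /shadowP[j jY].
rewrite inE in_setU1 negb_or => /andP[jYF' /andP[ej eY]].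
have jV : j \in V.
  by case/drawsP: (subsetP F'V _ jYF') => /subsetP-> //; rewrite setU11.
apply/mem_linkP; split=> //; rewrite -[_ \in _]negbK; apply/negP => eYF'.
have /maxF' : P (compress e j F').
  rewrite /P compress_draws // card_compress cF' eqxx /=.
  apply: leq_trans sF'; rewrite -(card_compress e j (shadow F')).
  exact: subset_leq_card (shadow_compress e j F').
apply/negP; rewrite -ltnNge !card_link; apply: proper_card; apply/properP; split.
  apply/subsetP => X; rewrite !inE => /andP[XF' eX].
  by rewrite eX XF' /=; case: ifP.
have swY : swap e j (e |: Y) = j |: Y.
  by rewrite swap_setU1 tpermL swap_id // (negPf eY) (negPf jY).
exists (e |: Y); rewrite !inE eqxx /=; last by rewrite (negPf eYF').
by rewrite swY jYF' orbT /= [j == e]eq_sym (negPf ej) (negPf jY).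
Qed.

(* After shifting [F] towards [e], the shadow of the sets avoiding [e] lies in
   the link of [e]; so if the link had fewer than [p] sets, the first
   hypothesis applied to the more than [q] sets avoiding [e] would be
   contradicted. *)
Lemma shadow_step (R : realFieldType) (T : finType) (V : {set T}) (r : nat)
    (p q p' : R) (e : T) (F : {set {set T}}) :
  e \in V -> F \subset draws V r.+2 ->
  (forall H : {set {set T}}, H \subset draws (V :\ e) r.+2 ->
     q < #|H|%:R -> p <= #|shadow H|%:R)%R ->
  (forall H : {set {set T}}, H \subset draws (V :\ e) r.+1 ->
     p <= #|H|%:R -> p' <= #|shadow H|%:R)%R ->
  (p + q <= #|F|%:R -> p + p' <= #|shadow F|%:R)%R.
Proof.
move=> eV FV0 IH0 IH1 pqF0.
have [F' [FV cF sF shF]] := exists_shifted eV FV0.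
rewrite -cF in pqF0; apply: le_trans (_ : _ <= #|shadow F'|%:R)%R _; last first.
  by rewrite ler_nat.
have p_link : (p <= #|link e F'|%:R)%R.
  rewrite leNgt; apply/negP => lt_p.
  have /IH0 : avoid e F' \subset draws (V :\ e) r.+2 by exact: avoid_draws.
  have lt_q : (q < #|avoid e F'|%:R)%R.
    move: pqF0; rewrite (card_link_avoid e) natrD => le_pq.
    by rewrite -(ltrD2l p) (le_lt_trans le_pq) // ltrD2r.
  move/(_ lt_q); rewrite leNgt (le_lt_trans _ lt_p) // ler_nat.
  exact: subset_leq_card shF.
rewrite (card_link_avoid e (shadow F')) addnC natrD lerD //.
  apply: le_trans p_link _; rewrite ler_nat.
  exact: subset_leq_card (link_sub_shadow e F').
apply: le_trans (IH1 _ (link_draws e FV) p_link) _; rewrite ler_nat.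
exact: subset_leq_card (link_shadow e F').
Qed.

(** * Binomial polynomials at real arguments and shadow bounds of Kruskal-Katona type *)

Local Open Scope ring_scope.

(** The binomial coefficient as a polynomial in its upper argument. *)
Definition rbin (R : unitRingType) (x : R) (r : nat) : R :=
  (\prod_(i < r) (x - i%:R)) / r`!%:R.

Lemma rbin0 (R : unitRingType) (x : R) : rbin x 0 = 1.
Proof. by rewrite /rbin big_ord0 fact0 divr1. Qed.

Lemma rbinS (R : numFieldType) (x : R) (r : nat) :
  rbin x r.+1 = rbin x r * (x - r%:R) / r.+1%:R.
Proof.
rewrite /rbin big_ord_recr /= factS natrM.
have ? : r.+1%:R != 0 :> R by rewrite pnatr_eq0.
have ? : r`!%:R != 0 :> R by rewrite pnatr_eq0 -lt0n fact_gt0.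
by field; rewrite nat1r; apply/andP.
Qed.

Lemma rbinSE (R : numFieldType) (x : R) (r : nat) :
  rbin x r.+1 * r.+1%:R = rbin x r * (x - r%:R).
Proof. by rewrite rbinS divfK // pnatr_eq0. Qed.

Lemma rbin_pascal (R : numFieldType) (x : R) (r : nat) :
  rbin x r.+1 = rbin (x - 1) r.+1 + rbin (x - 1) r.
Proof.
elim: r => [|r IHr]; first by rewrite !rbinS !rbin0; field.
have recE := rbinSE (x - 1) r.
rewrite [LHS]rbinS IHr [rbin (x - 1) r.+2]rbinS.
have ? : r.+2%:R != 0 :> R by rewrite pnatr_eq0.
apply: (mulIf (_ : r.+2%:R != 0)) => //; rewrite divfK // [RHS]mulrDl divfK //.
rewrite -!natr1 in recE *.
have -> : rbin (x - 1) r.+1 * (x - 1 - (r%:R + 1)) + rbin (x - 1) r.+1 * (r%:R + 1 + 1)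
  = rbin (x - 1) r.+1 * (r%:R + 1) + rbin (x - 1) r.+1 * (x - r%:R - 1) by ring.
by rewrite recE; ring.
Qed.

Lemma rbin_nat (R : numFieldType) (n r : nat) : rbin n%:R r = 'C(n, r)%:R :> R.
Proof.
elim: r => [|r IHr]; first by rewrite rbin0 bin0.
have ? : r.+1%:R != 0 :> R by rewrite pnatr_eq0.
apply: (mulIf (_ : r.+1%:R != 0)) => //.
rewrite rbinSE IHr -natrM [in RHS]mulnC mul_bin_left.
have [le_rn|lt_nr] := leqP r n; first by rewrite -natrB // -natrM mulnC.
by rewrite bin_small // mul0r muln0.
Qed.

Lemma rbin_gt0 (R : realFieldType) (x : R) (r : nat) :
  r%:R - 1 < x -> 0 < rbin x r.
Proof.
move=> ltx; rewrite divr_gt0 ?ltr0n ?fact_gt0 // prodr_gt0 // => i _.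
have : i.+1%:R <= r%:R :> R by rewrite ler_nat.
by rewrite -natr1; lra.
Qed.

Lemma ler_rbin (R : realFieldType) (x y : R) (r : nat) :
  r%:R - 1 <= x -> x <= y -> rbin x r <= rbin y r.
Proof.
move=> lex lexy; rewrite ler_pM2r ?invr_gt0 ?ltr0n ?fact_gt0 //.
apply: ler_prod => i _; have : i.+1%:R <= r%:R :> R by rewrite ler_nat.
by rewrite -natr1; lra.
Qed.

Lemma rbin_ge0 (R : realFieldType) (x : R) (r : nat) :
  r%:R - 1 <= x -> 0 <= rbin x r.
Proof.
move=> lex; rewrite divr_ge0 ?ler0n // prodr_ge0 // => i _.
have : i.+1%:R <= r%:R :> R by rewrite ler_nat.
by rewrite -natr1; lra.
Qed.

(** Real closedness gives polynomials the intermediate value property; this is how the size of a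
    family gets written as a binomial polynomial at some [x]. *)
Lemma rbin_ivt (R : rcfType) (a b N : R) (r : nat) :
  a <= b -> rbin a r <= N <= rbin b r ->
  exists2 x, a <= x <= b & rbin x r = N.
Proof.
move=> leab /andP[leN geN].
pose p : {poly R} := (\prod_(i < r) ('X - i%:R%:P)) * (r`!%:R^-1)%:P - N%:P.
have pE x : p.[x] = rbin x r - N.
  rewrite /p !hornerE horner_prod; congr (_ * _ - _).
  by apply: eq_bigr => i _; rewrite !hornerE.
have [|x xab /rootP] := @poly_ivt R p a b leab; first by rewrite !pE; lra.
by rewrite pE => /subr0_eq xN; exists x.
Qed.

(* Here [F] is split along a point [e] as in Frankl's proof; [x - 1] may drop
   below [r.+2], where a single set already has a large enough shadow. *)
Lemma shadow_lovasz (R : realFieldType) (T : finType) (V : {set T}) (r : nat)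
    (x : R) (F : {set {set T}}) :
  F \subset draws V r.+1 -> r.+1%:R <= x ->
  rbin x r.+1 <= #|F|%:R -> rbin x r <= #|shadow F|%:R.
Proof.
have [n] := ubnP #|V|; elim: n V r x F => // n IHn V r x F ltVn FV rx cF.
have Fpos : (0 < #|F|)%N.
  rewrite -(ltr0n R); apply: lt_le_trans cF; apply: rbin_gt0.
  by apply: lt_le_trans rx; lra.
case: r => [|r] in FV rx cF *.
  rewrite rbin0 ler1n card_gt0; apply: contraTneq Fpos => /(shadow_eq0 FV) ->.
  by rewrite cards0.
have [X XF] : exists X, X \in F by apply/card_gt0P.
have /drawsP[/subsetP XV cX] := subsetP FV X XF.
have [e eX] : exists e, e \in X by apply/card_gt0P; rewrite cX.
have eV := XV e eX.
have ltVe : (#|V :\ e| < n)%N by move: ltVn; rewrite (cardsD1 e V) eV.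
rewrite -natr1 in rx.
rewrite rbin_pascal addrC in cF; rewrite rbin_pascal.
apply: shadow_step eV FV _ _ cF => H HV.
  have [rx1|x1r] := leP r.+2%:R (x - 1).
    by move/ltW; apply: IHn HV rx1.
  have q_ge0 : 0 <= rbin (x - 1) r.+2 by apply: rbin_ge0; rewrite -natr1; lra.
  move/(le_lt_trans q_ge0); rewrite ltr0n => Hpos.
  have := IHn _ r.+1 r.+2%:R H ltVe HV (lexx _).
  rewrite rbin_nat binn ler1n => /(_ Hpos); apply: le_trans.
  by apply: ler_rbin; [lra | exact: ltW].
by apply: IHn HV _ => //; lra.
Qed.

(** Induction on [a] by [shadow_step] at an arbitrary point of [V]: Pascal's rule applied to both
    terms splits the bound into instances with [a] and [x] lowered by one. *)
Lemma shadow_two_term (R : realFieldType) (T : finType) (a : nat) (V : {set T})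
    (r : nat) (x : R) (F : {set {set T}}) :
  #|V| = a.+1 -> F \subset draws V r.+2 -> r.+1%:R <= x <= a%:R ->
  'C(a, r.+2)%:R + rbin x r.+1 <= #|F|%:R ->
  'C(a, r.+1)%:R + rbin x r <= #|shadow F|%:R.
Proof.
elim: a V r x F => [|a IHa] V r x F cV FV /andP[rx xa] cF.
  by have := ltr0Sn R r; lra.
have [e eV] : exists e, e \in V by apply/card_gt0P; rewrite cV.
have cVe : #|V :\ e| = a.+1 by move: cV; rewrite (cardsD1 e) eV => -[].
have rx1 : r%:R <= x - 1 by move: rx; rewrite -natr1; lra.
have xa1 : x - 1 <= a%:R by move: xa; rewrite -natr1; lra.
(* If [r >= a] then [r = a] and [x = a.+1], and the premise only says that [F] is nonempty. *)
have [lt_ra|le_ar] := ltnP r a; last first.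
  have eq_ra : r = a.
    by apply/eqP; rewrite eqn_leq le_ar -(ler_nat R) (le_trans rx1).
  subst r.
  have xE : x = a.+1%:R by apply/eqP; rewrite eq_le xa rx.
  have := @shadow_lovasz R _ _ _ _ _ FV (lexx _).
  move: cF; rewrite xE !rbin_nat !binn bin_small // binSn add0r => cF.
  by move/(_ cF); rewrite binSn -natrD add1n.
(* [low] stands for [rbin (x - 1) (r - 1)], read as 0 when [r = 0]. *)
pose low := if r is r'.+1 then rbin (x - 1) r' else 0.
have -> : 'C(a.+1, r.+1)%:R + rbin x r =
    ('C(a, r.+1)%:R + rbin (x - 1) r) + ('C(a, r)%:R + low).
  rewrite binS natrD /low; case: (r) => [|r']; first by rewrite !rbin0; lra.
  by rewrite (rbin_pascal x); lra.
apply: (@shadow_step R T V r _ ('C(a, r.+2)%:R + rbin (x - 1) r.+1) _ e) => //.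
- move=> H HV ltH; have [rx2|x1r] := leP r.+1%:R (x - 1).
    by apply: (IHa (V :\ e)) (ltW ltH); rewrite ?rx2.
  (* When [x - 1 < r.+1] the induction hypothesis is applied at [r.+1] instead: by integrality [H]
     has at least one set beyond ['C(a, r.+2)]. *)
  have q_ge0 : 0 <= rbin (x - 1) r.+1 by apply: rbin_ge0; rewrite -natr1; lra.
  have ltH' : ('C(a, r.+2) < #|H|)%N by rewrite -(ltr_nat R); lra.
  have := IHa _ r r.+1%:R H cVe HV.
  rewrite lexx ler_nat lt_ra !rbin_nat binn natr1 ler_nat => /(_ isT ltH').
  apply: le_trans; rewrite lerD2l -rbin_nat; apply: ler_rbin; [lra|exact: ltW].
- move=> H HV leH; rewrite /low {low}; case: r => [|r] in rx rx1 HV leH lt_ra cF FV xa *.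
    rewrite bin0 addr0 ler1n card_gt0; apply/eqP => /(shadow_eq0 HV) H0.
    by move: leH; rewrite H0 cards0 rbin0; have := ler0n R 'C(a, 1); lra.
  by apply: (IHa (V :\ e)) leH; rewrite ?rx1.
- by move: cF; rewrite binS natrD rbin_pascal; lra.
Qed.

(** * Covered families: iterating shadows downwards and cliques upwards *)

Definition covers (T : finType) (l : nat) (F G : {set {set T}}) : Prop :=
  forall X Y : {set T}, X \in F -> Y \subset X -> #|Y| = l -> Y \in G.

Lemma covers_shadow (T : finType) (l : nat) (F G : {set {set T}}) :
  covers l F G -> covers l (shadow F) G.
Proof.
move=> FG X Y /shadowP[z zX zXF] YX; apply: FG zXF _.
by apply: subset_trans YX _; apply: subsetUr.
Qed.

(** Replacing [F] by its shadow preserves [covers], so a level-by-level bound [f] can be iterated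
    [d] times; at level [l] the family is contained in [G]. *)
Lemma card_covers_shadow (R : realFieldType) (T : finType) (V : {set T})
    (f : nat -> R) (l d : nat) (F G : {set {set T}}) :
  (forall j (H : {set {set T}}), (l <= j < l + d)%N -> H \subset draws V j.+1 ->
     f j.+1 <= #|H|%:R -> f j <= #|shadow H|%:R) ->
  F \subset draws V (l + d) -> covers l F G ->
  f (l + d)%N <= #|F|%:R -> f l <= #|G|%:R.
Proof.
elim: d F => [|d IHd] F sh FV FG cF.
  rewrite addn0 in FV cF; apply: le_trans cF _; rewrite ler_nat.
  apply: subset_leq_card; apply/subsetP => X XF.
  by have /drawsP[_ cX] := subsetP FV X XF; apply: FG XF _ cX.
rewrite addnS in sh FV cF; apply: (IHd (shadow F)).
- by move=> j H /andP[lj jd]; apply: sh; rewrite lj leqW.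
- exact: shadow_draws.
- exact: covers_shadow.
- by apply: sh cF => //; rewrite leq_addr leqnn.
Qed.

(** The largest family of [l.+1]-sets whose shadow lies in [G]; it lets an induction climb from [G]
    instead of descending from [F]. *)
Definition cliques (T : finType) (l : nat) (G : {set {set T}}) : {set {set T}} :=
  [set X : {set T} | (#|X| == l.+1) && [forall z in X, X :\ z \in G]].

Lemma shadow_cliques (T : finType) (l : nat) (G : {set {set T}}) :
  shadow (cliques l G) \subset G.
Proof.
apply/subsetP => Y /shadowP[z zY]; rewrite inE => /andP[_ /forall_inP/(_ z)].
by rewrite setU11 setU1K //; apply.
Qed.

Lemma cliques_draws (T : finType) (l : nat) (G : {set {set T}}) :
  cliques l G \subset draws setT l.+1.
Proof. by apply/subsetP => X; rewrite !inE subsetT => /andP[]. Qed.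

Lemma covers_cliques (T : finType) (l : nat) (F G : {set {set T}}) :
  covers l F G -> covers l.+1 F (cliques l G).
Proof.
move=> FG X Y XF YX cY; rewrite inE cY eqxx; apply/forall_inP => z zY.
apply: FG XF _ _; first exact: subset_trans (subD1set _ _) YX.
by move: cY; rewrite (cardsD1 z) zY => -[].
Qed.

Lemma card_cliques (T : finType) (a l : nat) (G : {set {set T}}) :
  (l <= a)%N -> G \subset draws setT l.+1 -> (#|G| <= 'C(a.+1, l.+1))%N ->
  (l.+2 * #|cliques l.+1 G| <= (a - l) * #|G|)%N.
Proof.
move=> la GV cG.
by case: (clique_count la GV (cliques_draws _ _) (shadow_cliques _ _) cG).
Qed.

(** Induction upwards from [G]: its cliques cover [F] one level higher, and by [card_cliques]
    passing to them does not increase the ratio of the size to the binomial coefficient. *)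
Lemma card_covers (T : finType) (a l d : nat) (F G : {set {set T}}) :
  (l + d <= a)%N -> G \subset draws setT l.+1 -> F \subset draws setT (l + d).+1 ->
  (#|G| <= 'C(a.+1, l.+1))%N -> covers l.+1 F G ->
  (#|F| * 'C(a.+1, l.+1) <= #|G| * 'C(a.+1, (l + d).+1))%N.
Proof.
elim: d l G => [|d IHd] l G lda GV FV cG FG.
  rewrite addn0 in FV *; rewrite leq_mul2r; apply/orP; right.
  apply: subset_leq_card; apply/subsetP => X XF.
  by have /drawsP[_ cX] := subsetP FV X XF; apply: FG XF _ cX.
have la : (l < a)%N by apply: leq_trans lda; rewrite addnS ltnS leq_addr.
have cCl := card_cliques (ltnW la) GV cG.
have binE := mul_bin_left a.+1 l.+1; rewrite subSS in binE.
have cCl' : (#|cliques l.+1 G| <= 'C(a.+1, l.+2))%N.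
  rewrite -(leq_pmul2l (ltn0Sn l.+1)) (leq_trans cCl) // binE.
  by rewrite leq_mul2l cG orbT.
rewrite addnS -addSn in lda FV *.
have := IHd _ _ lda (cliques_draws l.+1 G) FV cCl' (covers_cliques FG).
set f := #|F|; set g := #|G| in cCl *; set h := #|cliques _ _| in cCl *.
set K := 'C(_, (_ + d).+1); move=> IH.
have al : (0 < a - l)%N by rewrite subn_gt0.
rewrite -(leq_pmul2l al) mulnCA -binE.
apply: leq_trans (_ : l.+2 * (h * K) <= _)%N.
  by rewrite mulnCA leq_mul2l IH orbT.
by rewrite !mulnA leq_mul2r cCl orbT.
Qed.

(** Members of [F] are larger than those of [G], so at least one passage to cliques takes place; the
    size of [F] forces ['C(a.+1, l.+2)] cliques, which is equality in [clique_count]. *)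
Lemma card_covers_eq (T : finType) (a l d : nat) (F G : {set {set T}}) :
  (l + d < a)%N -> G \subset draws setT l.+1 ->
  F \subset draws setT (l + d).+2 ->
  (#|G| <= 'C(a.+1, l.+1))%N -> covers l.+1 F G ->
  ('C(a.+1, (l + d).+2) <= #|F|)%N ->
  exists2 Y : {set T}, #|Y| = a.+1 & G = draws Y l.+1.
Proof.
move=> lda GV FV cG FG cF.
have la : (l < a)%N by apply: leq_ltn_trans lda; rewrite leq_addr.
have binE := mul_bin_left a.+1 l.+1; rewrite subSS in binE.
have [cCl eqCl] := clique_count (ltnW la) GV (cliques_draws _ _) (shadow_cliques _ _) cG.
have cCl' : (#|cliques l.+1 G| <= 'C(a.+1, l.+2))%N.
  rewrite -(leq_pmul2l (ltn0Sn l.+1)) (leq_trans cCl) // binE.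
  by rewrite leq_mul2l cG orbT.
have geCl : ('C(a.+1, l.+2) <= #|cliques l.+1 G|)%N.
  rewrite -addSn in lda FV cF.
  have := card_covers lda (cliques_draws l.+1 G) FV cCl' (covers_cliques FG).
  have Cpos : (0 < 'C(a.+1, (l.+1 + d).+1))%N by rewrite bin_gt0.
  move=> IH; rewrite -(leq_pmul2r Cpos); apply: leq_trans IH.
  by rewrite mulnC leq_mul2r cF orbT.
have lCl : ((a - l) * #|G| <= l.+2 * #|cliques l.+1 G|)%N.
  apply: leq_trans (_ : (a - l) * 'C(a.+1, l.+1) <= _)%N.
    by rewrite leq_mul2l cG orbT.
  by rewrite -binE leq_mul2l geCl orbT.
apply: eqCl; first by apply/eqP; rewrite eqn_leq cCl lCl.
apply: contraTneq geCl => G0; rewrite -ltnNge.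
move: cCl; rewrite G0 cards0 muln0 leqn0 muln_eq0 /= => /eqP->.
by rewrite bin_gt0 ltnS.
Qed.

(** * Weierstrass's product inequalities and the resulting numerical estimates *)

Lemma prod_1D_ge (R : realFieldType) (I : Type) (s : seq I) (P : pred I)
    (a : I -> R) :
  (forall i, P i -> 0 <= a i) ->
  1 + \sum_(i <- s | P i) a i <= \prod_(i <- s | P i) (1 + a i).
Proof.
move=> a_ge0; elim: s => [|i s IHs]; first by rewrite !big_nil addr0.
rewrite !big_cons; case: ifP => // /a_ge0 ai.
have : 0 <= \sum_(j <- s | P j) a j by apply: sumr_ge0.
by nra.
Qed.

Lemma prod_1B_ge (R : realFieldType) (I : Type) (s : seq I) (P : pred I)
    (a : I -> R) :
  (forall i, P i -> 0 <= a i <= 1) ->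
  1 - \sum_(i <- s | P i) a i <= \prod_(i <- s | P i) (1 - a i).
Proof.
(* The induction also needs the product to stay between 0 and 1. *)
move=> a01; suff : 1 - \sum_(i <- s | P i) a i <= \prod_(i <- s | P i) (1 - a i)
  /\ 0 <= \prod_(i <- s | P i) (1 - a i) <= 1 by case.
elim: s => [|i s [IHs /andP[p0 p1]]]; first by rewrite !big_nil subr0 lexx ler01.
rewrite !big_cons; case: ifP => [/a01/andP[ai0 ai1]|_]; last by rewrite p0 p1.
by split; [nra | apply/andP; split; nra].
Qed.

Lemma rbin_ratio (R : realFieldType) (x y : R) (r : nat) :
  r%:R <= x ->
  rbin y r = rbin x r * \prod_(0 <= i < r) (1 + (y - x) / (x - i%:R)).
Proof.
move=> rx; rewrite /rbin mulrAC; congr (_ / _).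
rewrite big_mkord -big_split /=; apply: eq_bigr => i _.
have : i.+1%:R <= r%:R :> R by rewrite ler_nat.
rewrite -natr1 => ir; have xi : x - i%:R != 0 by rewrite subr_eq0; lra.
by field.
Qed.

(** After Weierstrass's inequality the denominators [x - i] are raised to [y - i], so that [x]
    survives only in the factor [y - x] and one condition at [y] serves every [x]. *)
Lemma prod_ratio_ge (R : realFieldType) (x y : R) (m n : nat) :
  n%:R <= x -> x <= y ->
  1 + (y - x) * \sum_(m <= i < n) (y - i%:R)^-1 <=
    \prod_(m <= i < n) (1 + (y - x) / (x - i%:R)).
Proof.
move=> nx xy.
have x_gt i : (i < n)%N -> i%:R < x.
  by move=> lt_in; apply: lt_le_trans nx; rewrite ltr_nat.
rewrite mulr_sumr [in X in X <= _]big_nat [in X in _ <= X]big_nat.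
apply: le_trans (prod_1D_ge _ _); last first.
  by move=> i /andP[_ /x_gt xi]; rewrite divr_ge0 // subr_ge0 // ltW.
rewrite lerD2l; apply: ler_sum => i /andP[_ /x_gt xi].
rewrite ler_wpM2l ?subr_ge0 // lef_pV2 ?posrE ?subr_gt0 ?(lt_le_trans xi) //.
by rewrite lerD2r.
Qed.

(** Each inverted factor equals [1 - (y - x) / (y - i)], so Weierstrass's inequality applies
    directly. *)
Lemma prod_ratio_inv_ge (R : realFieldType) (x y : R) (m n : nat) :
  n%:R <= x -> x <= y ->
  1 - (y - x) * \sum_(m <= i < n) (y - i%:R)^-1 <=
    (\prod_(m <= i < n) (1 + (y - x) / (x - i%:R)))^-1.
Proof.
move=> nx xy.
have x_gt i : (i < n)%N -> i%:R < x.
  by move=> lt_in; apply: lt_le_trans nx; rewrite ltr_nat.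
rewrite -prodfV mulr_sumr [in X in X <= _]big_nat [in X in _ <= X]big_nat.
have -> : \prod_(m <= i < n | (m <= i < n)%N) (1 + (y - x) / (x - i%:R))^-1 =
    \prod_(m <= i < n | (m <= i < n)%N) (1 - (y - x) / (y - i%:R)).
  apply: eq_bigr => i /andP[_ /x_gt xi].
  have xi0 : x - i%:R != 0 by rewrite subr_eq0; lra.
  have yi0 : y - i%:R != 0 by rewrite subr_eq0; lra.
  have -> : 1 + (y - x) / (x - i%:R) = (y - i%:R) / (x - i%:R) by field.
  by field; apply/andP.
apply: prod_1B_ge => i /andP[_ /x_gt xi].
rewrite divr_ge0 ?subr_ge0 ?(ltW (lt_le_trans xi xy)) //=.
by rewrite ler_pdivrMr ?subr_gt0 ?(lt_le_trans xi) // mul1r; lra.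
Qed.

Lemma prod_ratio_ge1 (R : realFieldType) (x y : R) (m n : nat) :
  n%:R <= x -> x <= y -> 1 <= \prod_(m <= i < n) (1 + (y - x) / (x - i%:R)).
Proof.
move=> nx xy; apply: le_trans (prod_ratio_ge m nx xy).
rewrite lerDl mulr_ge0 ?subr_ge0 // big_nat sumr_ge0 // => i /andP[_ lt_in].
rewrite invr_ge0 subr_ge0; apply: le_trans xy; apply: le_trans nx.
by rewrite ler_nat ltnW.
Qed.

(* With [S], [T] the products of [(y - i) / (x - i)] over [i < s] and
   [s <= i < r], the claim is [(b - a) * (1 - 1 / S) <= a * (T - 1)], which
   follows from Weierstrass' product inequalities. *)
Lemma rbin_ratio_compare (R : realFieldType) (x y a b : R) (s r : nat) :
  (s <= r)%N -> r%:R <= x -> x <= y -> 0 <= a <= b ->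
  b * \sum_(0 <= i < s) (y - i%:R)^-1 <= a * \sum_(0 <= i < r) (y - i%:R)^-1 ->
  b * (rbin y s / rbin x s - 1) <= a * (rbin y r / rbin x r - 1).
Proof.
move=> sr rx xy /andP[a0 ab] le_sum.
have sx : s%:R <= x by apply: le_trans rx; rewrite ler_nat.
have bs0 : rbin x s != 0 by rewrite gt_eqF // rbin_gt0 //; lra.
have br0 : rbin x r != 0 by rewrite gt_eqF // rbin_gt0 //; lra.
rewrite (rbin_ratio y sx) (rbin_ratio y rx) ![rbin x _ * _]mulrC !mulfK //.
have geS := prod_ratio_inv_ge 0 sx xy.
have S1 := prod_ratio_ge1 0 sx xy.
have geT := prod_ratio_ge s rx xy.
rewrite !(big_cat_nat (m := 0) (n := s) (p := r)) //= in le_sum *.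
move: geS S1 geT le_sum.
set S := \prod_(0 <= i < s) _; set T := \prod_(s <= i < r) _.
set sS := \sum_(0 <= i < s) _; set sT := \sum_(s <= i < r) _.
move=> geS S1 geT le_sum.
have S0 : S != 0 by rewrite gt_eqF //; lra.
rewrite -subr_ge0; have -> : a * (S * T - 1) - b * (S - 1) =
  S * (a * (T - 1) - (b - a) * (1 - S^-1)) by field.
rewrite mulr_ge0 ?subr_ge0 //; first lra.
apply: le_trans (_ : (b - a) * ((y - x) * sS) <= _).
  by rewrite ler_wpM2l ?subr_ge0 //; lra.
apply: le_trans (_ : a * ((y - x) * sT) <= _); last first.
  by rewrite ler_wpM2l //; lra.
rewrite mulrCA [X in _ <= X]mulrCA ler_wpM2l ?subr_ge0 //; lra.
Qed.

(** With [p] and [q] the ratios of the values at [N] and [y] for [k] and [m], the claim is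
    [rbin N%:R k * (1 - p^-1) <= D * (q - 1)]. The product inequalities bound [1 - p^-1] above and
    [q - 1] below by multiples of [N - y], and the last premise compares the slopes. *)
Lemma rbin_mul_diff_le (R : realFieldType) (y : R) (N m k : nat) (D : R) :
  (k <= m)%N -> m%:R <= y <= N%:R -> 0 <= D ->
  rbin N%:R k * (k%:R / (N%:R + 1 - k%:R)) <= D * (m%:R / N%:R) ->
  rbin y m * (D + rbin N%:R k - rbin y k) <= rbin N%:R m * D.
Proof.
move=> km /andP[my yN] D0 le_D.
have ky : k%:R <= y by apply: le_trans my; rewrite ler_nat.
have bm0 : 0 < rbin y m by rewrite rbin_gt0 //; lra.
have bk0 : 0 < rbin y k by rewrite rbin_gt0 //; lra.
have Nk : k%:R <= N%:R :> R by lra.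
have bN0 : 0 < rbin N%:R k :> R by apply: rbin_gt0; lra.
have lt_i i n : (n%:R <= y) -> (i < n)%N -> i%:R + 1 <= y.
  by move=> ny lt_in; rewrite natr1; apply: le_trans ny; rewrite ler_nat.
have Emk := rbin_ratio N%:R ky; have Emm := rbin_ratio N%:R my.
have := prod_ratio_ge 0 my yN; have := prod_ratio_inv_ge 0 ky yN.
have := prod_ratio_ge1 0 ky yN.
set p := \prod_(0 <= i < k) _ in Emk *; set q := \prod_(0 <= i < m) _ in Emm *.
move=> p1 geP geQ; have p0 : 0 < p by lra.
have sumQ : m%:R / N%:R <= \sum_(0 <= i < m) (N%:R - i%:R)^-1 :> R.
  have -> : m%:R / N%:R = \sum_(0 <= i < m) N%:R^-1 :> R.
    by rewrite sumr_const_nat subn0 mulr_natl.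
  apply: ler_sum_nat => i /andP[_ /(lt_i _ _ my) iy]; rewrite lef_pV2 ?posrE; last 2 first.
  - by have := ler0n R i; lra.
  - by lra.
  by have := ler0n R i; lra.
have sumP : \sum_(0 <= i < k) (N%:R - i%:R)^-1 <= k%:R / (N%:R + 1 - k%:R) :> R.
  have -> : k%:R / (N%:R + 1 - k%:R) = \sum_(0 <= i < k) (N%:R + 1 - k%:R)^-1 :> R.
    by rewrite sumr_const_nat subn0 mulr_natl.
  apply: ler_sum_nat => i /andP[_ ik]; have : i.+1%:R <= k%:R :> R by rewrite ler_nat.
  by rewrite -natr1 => ik'; rewrite lef_pV2 ?posrE; lra.
have t0 : 0 <= N%:R - y by lra.
have le1 : rbin N%:R k * (1 - p^-1) <= D * (q - 1).
  apply: le_trans (_ : (N%:R - y) * (rbin N%:R k * (k%:R / (N%:R + 1 - k%:R))) <= _).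
    rewrite mulrCA ler_wpM2l ?(ltW bN0) //.
    by apply: le_trans (ler_wpM2l t0 sumP); rewrite lerBlDl -lerBlDr.
  apply: le_trans (_ : (N%:R - y) * (D * (m%:R / N%:R)) <= _).
    by rewrite ler_wpM2l.
  rewrite mulrCA ler_wpM2l // lerBrDl; apply: le_trans geQ.
  by rewrite lerD2l ler_wpM2l.
have yk : rbin y k = rbin N%:R k * p^-1 by rewrite Emk mulfK // gt_eqF.
rewrite Emm -mulrA ler_pM2l // yk mulrC; lra.
Qed.

(* Here and below [n = N + 2], [k + 1] and [s + 1] stand for the [n], [k], [l]
   of the theorem; the last premise is its first hypothesis cleared of
   denominators. *)
Lemma product_condition (N k s : nat) :
  (k <= N)%N -> (s <= N)%N -> ((2 * N + 2 - k) * s < N.+1 ^ 2)%N ->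
  (N.+1 * (N.+1 - k) < N.+1 * (N.+1 - s) + (N.+1 - k) * (N.+1 - s))%N.
Proof.
move=> kN sN; have -> : (2 * N + 2 - k = N.+1 + (N.+1 - k))%N by lia.
have vE : (N.+1 = (N.+1 - s) + s)%N by lia.
set M := N.+1 in vE *; set u := (M - k)%N; set v := (M - s)%N in vE *.
have : (M * M = M * v + M * s)%N by rewrite -mulnDr -vE.
have : (u * M = u * v + u * s)%N by rewrite -mulnDr -vE.
move=> uM MM; rewrite mulnDl [(M * u)%N]mulnC -mulnn MM uM.
rewrite [(M * v + M * s)%N]addnC ltn_add2l => lt_us.
by rewrite [(u * v + _)%N]addnC ltn_add2r.
Qed.

(** Let [b], [c] be the two polynomials at [x], let [p], [q] be the ratios of their values at [N] to
    these, and put [al = M / u], [be = M / v]. The difference of the sides is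
    [- (b * c * (al * p + 1 - be * q))]; [rbin_ratio_compare] bounds the bracket below by
    [al + 1 - be], which is positive by [product_condition]. *)
Lemma two_term_product_lt (R : realFieldType) (N k s : nat) (x : R) :
  (k <= s)%N -> (k + s < N)%N -> ((2 * N + 2 - k) * s < N.+1 ^ 2)%N ->
  (N.+1 - k)%:R * \sum_(0 <= i < s) (N%:R - i%:R)^-1 <=
    (N.+1 - s)%:R * \sum_(0 <= i < N - k) (N%:R - i%:R)^-1 :> R ->
  (N - k)%:R <= x <= N%:R ->
  ('C(N.+1, k)%:R + rbin x (N - k)) * ('C(N.+1, s)%:R - rbin x s) <
    'C(N.+1, k)%:R * 'C(N.+1, s)%:R.
Proof.
move=> ks ksN h1 h2 /andP[rx xN].
have kN : (k <= N)%N by clear -ksN; lia.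
have sN : (s <= N)%N by clear -ksN; lia.
have {}h1 := product_condition kN sN h1.
rewrite -(ltr_nat R) natrD !natrM in h1.
have sr : (s <= N - k)%N by clear -ksN; lia.
have sx : s%:R <= x by apply: le_trans rx; rewrite ler_nat.
have u0 : 0 < (N.+1 - k)%:R :> R by rewrite ltr0n; clear -ksN; lia.
have v0 : 0 < (N.+1 - s)%:R :> R by rewrite ltr0n; clear -ksN; lia.
have bx0 : 0 < rbin x (N - k) by apply: rbin_gt0; lra.
have bs0 : 0 < rbin x s by apply: rbin_gt0; lra.
have M0 : 0 < N.+1%:R :> R by rewrite ltr0n.
have PE : 'C(N.+1, k)%:R = N.+1%:R / (N.+1 - k)%:R * rbin N%:R (N - k) :> R.
  rewrite rbin_nat bin_sub //.
  apply: (mulfI (lt0r_neq0 u0)); rewrite -natrM -mul_bin_down natrM.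
  by field; apply: lt0r_neq0.
have QE : 'C(N.+1, s)%:R = N.+1%:R / (N.+1 - s)%:R * rbin N%:R s :> R.
  rewrite rbin_nat; apply: (mulfI (lt0r_neq0 v0)); rewrite -natrM -mul_bin_down natrM.
  by field; apply: lt0r_neq0.
have uv : (N.+1 - s)%:R <= (N.+1 - k)%:R :> R by rewrite ler_nat leq_sub2l.
rewrite {}PE {}QE.
move: h1 h2 u0 v0 uv M0; set u := (N.+1 - k)%:R; set v := (N.+1 - s)%:R.
set M := N.+1%:R => h1 h2 u0 v0 uv M0.
have un0 := lt0r_neq0 u0; have vn0 := lt0r_neq0 v0.
have al0 : 0 <= M / u by rewrite divr_ge0 // ltW.
have al_be : M / u <= M / v by rewrite ler_pM2l // lef_pV2.
have be_lt : M / v < M / u + 1.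
  rewrite -subr_gt0; have -> : M / u + 1 - M / v = (M * v + u * v - M * u) / (u * v).
    by field; apply/andP.
  by rewrite divr_gt0 ?mulr_gt0 // subr_gt0.
have h2' : M / v * \sum_(0 <= i < s) (N%:R - i%:R)^-1 <=
    M / u * \sum_(0 <= i < N - k) (N%:R - i%:R)^-1 :> R.
  have -> : M / v = M / (u * v) * u by field; apply/andP.
  have -> : M / u = M / (u * v) * v by field; apply/andP.
  rewrite -![M / (u * v) * _ * _]mulrA ler_wpM2l //.
  by rewrite divr_ge0 ?mulr_ge0 //; exact: ltW.
have := rbin_ratio_compare sr rx xN _ h2'.
rewrite al0 al_be => /(_ isT).
have -> : rbin N%:R s = rbin N%:R s / rbin x s * rbin x s.
  by rewrite divfK // lt0r_neq0.
have -> : rbin N%:R (N - k) = rbin N%:R (N - k) / rbin x (N - k) * rbin x (N - k).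
  by rewrite divfK // lt0r_neq0.
rewrite !mulfK ?lt0r_neq0 //.
move: al0 al_be be_lt; move: (M / u) (M / v) (rbin _ _ / _) (rbin _ _ / _) => al be p q.
move: bx0 bs0; move: (rbin x _) (rbin x _) => c b b0 c0 al0 al_be be_lt cmp.
rewrite -subr_lt0.
have -> : (al * (p * b) + b) * (be * (q * c) - c) - al * (p * b) * (be * (q * c)) =
  - (b * c * (al * p + 1 - be * q)) by ring.
by rewrite oppr_lt0 !mulr_gt0 //; lra.
Qed.

(** Writing ['C(N.+2, k.+1)] as [D + 'C(N, k.+1)] with [D = 'C(N.+1, k) + 'C(N, k)] lets
    [rbin_mul_diff_le] move [y] up to [N]. The condition [h1] serves twice: for the slope comparison
    [bound] and for the strict inequality at [y = N]. *)
Lemma one_term_product_lt (R : realFieldType) (N k s : nat) (y : R) :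
  (k + s < N)%N -> ((2 * N + 2 - k) * s < N.+1 ^ 2)%N ->
  (N.+1 - s)%:R <= y <= N%:R ->
  rbin y (N.+1 - s) * ('C(N.+2, k.+1)%:R - rbin y k.+1) <
    'C(N.+1, k)%:R * 'C(N.+1, s)%:R.
Proof.
move=> ksN h1 /andP[vy yN].
have s_gt0 : (0 < s)%N.
  by have : (N.+1 - s <= N)%N; [rewrite -(ler_nat R) (le_trans vy) | lia].
have N0 : 0 < N%:R :> R by rewrite ltr0n; clear -ksN; lia.
have h1s : s%:R * (N.+1%:R + (N.+1 - k)%:R) < N.+1%:R * N.+1%:R :> R.
  rewrite -natrD -!natrM ltr_nat mulnC; apply: leq_trans h1.
  by rewrite ltnS leq_mul2r; apply/orP; right; lia.
have kN : (k <= N)%N by clear -ksN; lia.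
have sN : (s <= N)%N by clear -ksN; lia.
have {}h1 := product_condition kN sN h1.
rewrite -(ltr_nat R) natrD !natrM in h1.
have u0 : 0 < (N.+1 - k)%:R :> R by rewrite ltr0n; clear -ksN; lia.
have v0 : 0 < (N.+1 - s)%:R :> R by rewrite ltr0n; clear -ksN; lia.
have M0 : 0 < N.+1%:R :> R by rewrite ltr0n.
have Nk0 : 0 < (N - k)%:R :> R by rewrite ltr0n; clear -ksN; lia.
have MN : N%:R < N.+1%:R :> R by rewrite ltr_nat.
have P0 : 0 < 'C(N, k)%:R :> R by rewrite ltr0n bin_gt0; clear -ksN; lia.
have Q0 : 0 < 'C(N.+1, s)%:R :> R by rewrite ltr0n bin_gt0; clear -ksN; lia.
have PE : N.+1%:R * 'C(N, k)%:R = (N.+1 - k)%:R * 'C(N.+1, k)%:R :> R.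
  by rewrite -!natrM -mul_bin_down.
have P'E : k.+1%:R * 'C(N, k.+1)%:R = (N - k)%:R * 'C(N, k)%:R :> R.
  by rewrite -!natrM mul_bin_left.
have cE : N.+1%:R * 'C(N, N.+1 - s)%:R = s%:R * 'C(N.+1, s)%:R :> R.
  have -> : (N.+1 - s = N - s.-1)%N by clear -s_gt0; lia.
  rewrite bin_sub; last by clear -ksN; lia.
  by have := mul_bin_diag N.+1 s.-1; rewrite prednK //= -!natrM => ->.
have CE : 'C(N.+2, k.+1)%:R = 'C(N.+1, k)%:R + 'C(N, k)%:R + rbin N%:R k.+1 :> R.
  by rewrite rbin_nat !binS !natrD; lra.
rewrite CE.
have km : (k.+1 <= N.+1 - s)%N by clear -ksN; lia.
have bound : rbin N%:R k.+1 * (k.+1%:R / (N%:R + 1 - k.+1%:R)) <=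
    ('C(N.+1, k)%:R + 'C(N, k)%:R) * ((N.+1 - s)%:R / N%:R) :> R.
  have -> : N%:R + 1 - k.+1%:R = (N - k)%:R :> R.
    rewrite natrB; last by clear -ksN; lia.
    by rewrite -natr1; ring.
  rewrite rbin_nat mulrA [_ * k.+1%:R]mulrC P'E mulrAC divff ?lt0r_neq0 // mul1r.
  rewrite mulrA ler_pdivlMr // -(ler_pM2l u0) [X in _ <= X]mulrA mulrDr -PE.
  move: h1 u0 v0 MN P0; move: (N.+1 - k)%:R (N.+1 - s)%:R (N.+1)%:R N%:R 'C(N, k)%:R.
  move=> u v M n c h1 u0 v0 Mn c0.
  have -> : u * (c * n) = c * (u * n) by ring.
  have -> : (M * c + u * c) * v = c * (M * v + u * v) by ring.
  rewrite ler_pM2l //; apply: le_trans (ltW h1).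
  by rewrite mulrC ler_pM2r // ltW.
have D0 : 0 <= 'C(N.+1, k)%:R + 'C(N, k)%:R :> R by rewrite -natrD ler0n.
have yab : (N.+1 - s)%:R <= y <= N%:R by rewrite vy.
apply: le_lt_trans (rbin_mul_diff_le km yab D0 bound) _.
rewrite rbin_nat -(ltr_pM2l u0) -(ltr_pM2l M0).
move: h1s PE cE P0 Q0.
move: (N.+1 - k)%:R N.+1%:R 'C(N, k)%:R 'C(N.+1, k)%:R 'C(N.+1, s)%:R 'C(N, N.+1 - s)%:R s%:R.
move=> u M p P Q c t h1s PE cE p0 Q0.
have -> : M * (u * (c * (P + p))) = (M * c) * (u * P + u * p) by ring.
have -> : M * (u * (P * Q)) = M * Q * (u * P) by ring.
rewrite cE -PE -subr_gt0.
have -> : M * Q * (M * p) - t * Q * (M * p + u * p) = Q * p * (M * M - t * (M + u)) by ring.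
by rewrite !mulr_gt0 // subr_gt0.
Qed.

(** * Cross-intersecting families through complements *)

Lemma card_compl (T : finType) (F : {set {set T}}) :
  #|[set ~: X | X in F]| = #|F|.
Proof. by rewrite card_imset //; apply: setC_inj. Qed.

Lemma compl_draws (T : finType) (k : nat) (F : {set {set T}}) :
  F \subset draws setT k -> [set ~: X | X in F] \subset draws setT (#|T| - k).
Proof.
move=> /subsetP FV; apply/subsetP => _ /imsetP[X /FV/drawsP[_ <-] ->].
by apply/drawsP; rewrite subsetT cardsCs setCK.
Qed.

Lemma covers_compl (T : finType) (l : nat) (A B : {set {set T}}) :
  (forall X Y, X \in A -> Y \in B -> X :&: Y != set0) ->
  covers l [set ~: X | X in A] (draws setT l :\: B).
Proof.
move=> AB _ Y /imsetP[X XA ->] YX cY; rewrite in_setD.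
have -> : Y \in draws setT l by apply/drawsP.
rewrite andbT; apply/negP => /(AB _ _ XA)/negP; apply.
by rewrite setI_eq0 disjoint_sym disjoints_subset.
Qed.

Lemma card_draws_diff (T : finType) (l : nat) (B : {set {set T}}) :
  B \subset draws setT l -> #|B| + #|draws setT l :\: B| = 'C(#|T|, l) :> nat.
Proof.
move=> BV; rewrite -cardsT -card_draws -(cardsID B (draws setT l)).
by rewrite (setIidPr BV).
Qed.

Lemma card_covers_lovasz (R : realFieldType) (T : finType) (l d : nat)
    (x : R) (F G : {set {set T}}) :
  F \subset draws setT (l + d) -> covers l F G -> (l + d)%:R <= x ->
  rbin x (l + d) <= #|F|%:R -> rbin x l <= #|G|%:R.
Proof.
move=> FV FG dx; apply: (card_covers_shadow (f := rbin x) _ FV FG) => j H.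
case/andP=> _ lt_j HV; apply: shadow_lovasz HV _.
by apply: le_trans dx; rewrite ler_nat.
Qed.

Lemma card_covers_two_term (R : realFieldType) (T : finType) (a l d : nat)
    (x : R) (F G : {set {set T}}) :
  #|T| = a.+1 -> F \subset draws setT (l.+2 + d) -> covers l.+2 F G ->
  (l.+1 + d)%:R <= x <= a%:R ->
  'C(a, l.+2 + d)%:R + rbin x (l.+1 + d) <= #|F|%:R ->
  'C(a, l.+2)%:R + rbin x l.+1 <= #|G|%:R.
Proof.
move=> cT FV FG /andP[dx xa].
apply: (card_covers_shadow (f := fun j => 'C(a, j)%:R + rbin x j.-1) _ FV FG).
case=> // j H /andP[_ lt_j] HV /=; apply: shadow_two_term HV _.
  by rewrite cardsT.
rewrite xa andbT; apply: le_trans dx; rewrite ler_nat; lia.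
Qed.

(** Since [al <= g * P / W] and [b = W + Q - g], everything rests on [W * Q - g * (W + Q - g) = (W -
    g) * (Q - g)], which is positive for [g < W < Q]. *)
Lemma star_product_arith (al b g W P Q : nat) :
  (al * W <= g * P)%N -> (g <= W)%N -> (0 < W < Q)%N -> (0 < P)%N ->
  (b + g = W + Q)%N ->
  (al * b <= P * Q)%N /\ ((al * b = P * Q)%N -> g = W /\ al = P).
Proof.
move=> alW gW /andP[W0 WQ] P0 bE.
have albW : (al * b * W <= g * b * P)%N.
  by rewrite mulnAC [(g * b * P)%N]mulnAC leq_mul2r alW orbT.
have [gE|g_neq] := eqVneq g W.
  subst g; have bQ : b = Q by lia.
  subst b; have alP : (al <= P)%N by rewrite -(leq_pmul2r W0) [(P * W)%N]mulnC.
  split=> [|/eqP]; first by rewrite leq_mul2r alP orbT.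
  by rewrite eqn_pmul2r ?(ltn_trans W0 WQ) // => /eqP.
have gb : (g * b < W * Q)%N.
  have -> : b = (W + Q - g)%N by lia.
  have [u Wu] : exists u, W = (g + u)%N by exists (W - g)%N; lia.
  have [v Qv] : exists v, Q = (g + v)%N by exists (Q - g)%N; lia.
  have uv : (0 < u * v)%N by rewrite muln_gt0; lia.
  rewrite Wu Qv; have -> : (g + u + (g + v) - g = g + u + v)%N by lia.
  by rewrite !mulnDr !mulnDl; lia.
have lt : (al * b < P * Q)%N.
  rewrite -(ltn_pmul2r W0) (leq_ltn_trans albW) //.
  by rewrite mulnC -[(P * Q * W)%N]mulnA ltn_pmul2l // [(Q * W)%N]mulnC.
by split=> [|eq]; [exact: ltnW | rewrite eq ltnn in lt].
Qed.

(** The roles are exchanged: Lovasz's bound is applied to the complements of members of [B], all of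
    whose [k.+1]-subsets lie outside [A]. *)
Lemma card_product_lt_few (R : rcfType) (T : finType) (N k s : nat)
    (A B : {set {set T}}) :
  #|T| = N.+2 -> (k + s < N)%N -> ((2 * N + 2 - k) * s < N.+1 ^ 2)%N ->
  A \subset draws setT k.+1 -> B \subset draws setT s.+1 ->
  (forall X Y, X \in A -> Y \in B -> X :&: Y != set0) ->
  (#|B| <= 'C(N, s.-1))%N -> (0 < s)%N ->
  (#|A| * #|B| < 'C(N.+1, k) * 'C(N.+1, s))%N.
Proof.
move=> cT ksN h1 AV BV AB cB s_gt0.
have PQ0 : (0 < 'C(N.+1, k) * 'C(N.+1, s))%N by rewrite muln_gt0 !bin_gt0; lia.
have [->|B_gt0] := posnP #|B|; first by rewrite muln0.
have vN : (N.+1 - s <= N)%N by lia.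
have [||y yab yE] := @rbin_ivt R (N.+1 - s)%:R N%:R #|B|%:R (N.+1 - s).
- by rewrite ler_nat.
- rewrite !rbin_nat binn !ler_nat B_gt0.
  suff -> : 'C(N, N.+1 - s) = 'C(N, s.-1) by [].
  by rewrite -(bin_sub (_ : (s.-1 <= N)%N)); [congr 'C(_, _) |]; lia.
have BA X Y : X \in B -> Y \in A -> X :&: Y != set0.
  by rewrite setIC => XB YA; apply: AB.
have cov := covers_compl (l := k.+1) BA.
have := compl_draws BV; rewrite cT subSS.
have -> : (N.+1 - s = k.+1 + (N - s - k))%N by lia.
move=> FV; have := card_covers_lovasz (R := R) FV cov (x := y).
have <- : (N.+1 - s = k.+1 + (N - s - k))%N by lia.
rewrite card_compl yE lexx; case/andP: (yab) => -> _ /(_ isT isT) le_G.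
have AE := card_draws_diff AV; rewrite cT in AE.
rewrite -(ltr_nat R) !natrM.
apply: le_lt_trans (one_term_product_lt ksN h1 yab).
rewrite yE mulrC ler_wpM2l // -AE natrD; lra.
Qed.

Lemma card_product_lt (R : rcfType) (T : finType) (N k s : nat)
    (A B : {set {set T}}) :
  #|T| = N.+2 -> (k + s < N)%N -> (N < s.*2)%N ->
  ((2 * N + 2 - k) * s < N.+1 ^ 2)%N ->
  (N.+1 - k)%:R * \sum_(0 <= i < s) (N%:R - i%:R)^-1 <=
    (N.+1 - s)%:R * \sum_(0 <= i < N - k) (N%:R - i%:R)^-1 :> R ->
  A \subset draws setT k.+1 -> B \subset draws setT s.+1 ->
  (forall X Y, X \in A -> Y \in B -> X :&: Y != set0) ->
  (#|B| < 'C(N.+1, s))%N ->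
  (#|A| * #|B| < 'C(N.+1, k) * 'C(N.+1, s))%N.
Proof.
move=> cT ksN Ns h1 h2 AV BV AB ltB.
have P0 : (0 < 'C(N.+1, k))%N by rewrite bin_gt0; lia.
have s_gt0 : (0 < s)%N by lia.
have ks : (k <= s)%N by lia.
have [leA|ltA] := leqP #|A| 'C(N.+1, k).
  apply: leq_ltn_trans (_ : 'C(N.+1, k) * #|B| < _)%N; last by rewrite ltn_pmul2l.
  by rewrite leq_mul2r leA orbT.
have [leB|gtB] := leqP #|B| 'C(N, s.-1).
  exact: (@card_product_lt_few R).
have cov := covers_compl (l := s.+1) AB.
have FV := compl_draws AV; rewrite cT subSS in FV.
have GE := card_draws_diff BV; rewrite cT binS in GE.
have two x : (N - k)%:R <= x <= N%:R ->
    'C(N.+1, k)%:R + rbin x (N - k) <= #|A|%:R :> R ->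
    #|B|%:R <= 'C(N.+1, s)%:R - rbin x s.
  move=> /andP[rx xN] leA.
  case: s => // s in s_gt0 ksN Ns h1 h2 AB BV ltB ks gtB cov GE *.
  have Ek1 : (N.+1 - k = s.+2 + (N - k - s.+1))%N by lia.
  have Ek : (N - k = s.+1 + (N - k - s.+1))%N by lia.
  rewrite Ek1 in FV; have := card_covers_two_term (R := R) cT FV cov (x := x).
  rewrite -Ek1 -Ek rx card_compl bin_sub; last lia.
  have -> : x <= N.+1%:R by apply: le_trans xN _; rewrite ler_nat.
  move=> /(_ isT leA); have := congr1 (fun t => t%:R : R) GE.
  by rewrite !natrD; clear; lra.
have bNk : rbin N%:R (N - k) = 'C(N, k)%:R :> R by rewrite rbin_nat bin_sub //; lia.
(* Otherwise the two-term bound at [x = N] would give [#|B| <= 'C(N, s.-1)]. This cap on [#|A|] is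
   what keeps the [x] chosen next at most [N]. *)
have leA : (#|A| <= 'C(N.+1, k) + 'C(N, k))%N.
  rewrite leqNgt; apply/negP => ltA'; have := two N%:R.
  rewrite lexx ler_nat leq_subr bNk -natrD ler_nat => /(_ isT (ltnW ltA')).
  rewrite rbin_nat lerBrDr -natrD ler_nat leqNgt => /negP; apply.
  have -> : 'C(N.+1, s) = ('C(N, s) + 'C(N, s.-1))%N.
    by rewrite -{1 3}(prednK s_gt0) binS prednK.
  by rewrite addnC ltn_add2r.
have [||x xab xE] := @rbin_ivt R (N - k)%:R N%:R (#|A| - 'C(N.+1, k))%:R (N - k).
- by rewrite ler_nat leq_subr.
- by rewrite bNk rbin_nat binn !ler_nat; lia.
have AE : #|A|%:R = 'C(N.+1, k)%:R + rbin x (N - k) :> R.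
  by rewrite xE -natrD subnKC // ltnW.
rewrite -(ltr_nat R) !natrM; apply: le_lt_trans (two_term_product_lt ks ksN h1 h2 xab).
by rewrite -AE ler_wpM2l // two // AE.
Qed.

Lemma card_star (T : finType) (k : nat) (i : T) :
  #|[set X in draws setT k.+1 | i \in X]| = 'C(#|T|.-1, k) :> nat.
Proof.
rewrite -card_link -(cardsC1 i) -card_draws; apply: eq_card => X.
rewrite !inE subsetT subsetC sub1set inE; case: (boolP (i \in X)) => //= iX.
by rewrite cardsU1 iX.
Qed.

Lemma cross_intersecting_star (R : rcfType) (T : finType) (N k s : nat)
    (A B : {set {set T}}) :
  #|T| = N.+2 -> (k + s < N)%N -> (N < s.*2)%N ->
  ((2 * N + 2 - k) * s < N.+1 ^ 2)%N ->
  (N.+1 - k)%:R * \sum_(0 <= i < s) (N%:R - i%:R)^-1 <=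
    (N.+1 - s)%:R * \sum_(0 <= i < N - k) (N%:R - i%:R)^-1 :> R ->
  A \subset draws setT k.+1 -> B \subset draws setT s.+1 ->
  (forall X Y, X \in A -> Y \in B -> X :&: Y != set0) ->
  (#|A| * #|B| <= 'C(N.+1, k) * 'C(N.+1, s))%N /\
  ((#|A| * #|B|)%N = ('C(N.+1, k) * 'C(N.+1, s))%N ->
   exists i, A = [set X in draws setT k.+1 | i \in X] /\
             B = [set Y in draws setT s.+1 | i \in Y]).
Proof.
move=> cT ksN Ns h1 h2 AV BV AB.
have [leB|ltB] := leqP 'C(N.+1, s) #|B|; last first.
  have lt := card_product_lt cT ksN Ns h1 h2 AV BV AB ltB.
  by split=> [|eq]; [exact: ltnW | rewrite eq ltnn in lt].
have P0 : (0 < 'C(N.+1, k))%N by rewrite bin_gt0; lia.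
have W0 : (0 < 'C(N.+1, s.+1))%N by rewrite bin_gt0; lia.
have cov := covers_compl (l := s.+1) AB.
have FV := compl_draws AV; rewrite cT subSS in FV.
have GE := card_draws_diff BV; rewrite cT binS in GE.
(* The assumption [l > n/2] enters as [N.+1 - s < s.+1]. *)
have WQ : ('C(N.+1, s.+1) < 'C(N.+1, s))%N.
  rewrite -(ltn_pmul2l (ltn0Sn s)) mul_bin_left ltn_pmul2r ?bin_gt0; lia.
set G := draws setT s.+1 :\: B in cov GE *.
have GV : G \subset draws setT s.+1 by apply: subsetDl.
have leG : (#|G| <= 'C(N.+1, s.+1))%N by lia.
have CE : 'C(N.+1, N.+1 - k) = 'C(N.+1, k) by rewrite bin_sub //; lia.
have alW : (#|A| * 'C(N.+1, s.+1) <= #|G| * 'C(N.+1, k))%N.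
  have Ek : (N.+1 - k = (s + (N - k - s)).+1)%N by lia.
  rewrite -CE -card_compl Ek; rewrite Ek in FV.
  by apply: card_covers => //; lia.
have WQ' : (0 < 'C(N.+1, s.+1) < 'C(N.+1, s))%N by rewrite W0.
have [le_prod eq_prod] := star_product_arith alW leG WQ' P0 GE.
split=> // /eq_prod[cG cA].
have [Y cY GY] : exists2 Y : {set T}, #|Y| = N.+1 & G = draws Y s.+1.
  have Ek : (N.+1 - k = (s + (N - k - s.+1)).+2)%N by lia.
  rewrite Ek in FV; apply: (card_covers_eq _ GV FV leG cov); first lia.
  by rewrite -Ek CE card_compl cA.
have /card_gt0P[i iY] : (0 < #|~: Y|)%N.
  by have := cardsC Y; rewrite cY cT; lia.
rewrite inE in iY.
have YE : Y = [set~ i].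
  apply/eqP; rewrite eqEcard cardsC1 cT cY leqnn andbT; apply/subsetP => z zY.
  by rewrite !inE; apply: contraNneq iY => <-.
have inG X : X \in G = (i \notin X) && (#|X| == s.+1).
  by rewrite GY YE inE subsetC sub1set inE.
exists i; have BE : B = [set Y in draws setT s.+1 | i \in Y].
  apply/setP => X; rewrite [RHS]inE andbC; have := inG X; rewrite in_setD.
  have [XB|] := boolP (X \in B).
    have /drawsP[_ cX] := subsetP BV X XB.
    by rewrite inE subsetT cX eqxx /= => /esym/negbT; rewrite andbT negbK => ->.
  rewrite inE subsetT /=; case: (_ == _); rewrite ?andbF // !andbT.
  by case: (i \in X).
split=> //; apply/eqP; rewrite eqEcard card_star cT cA leqnn andbT.
apply/subsetP => X XA; have XV := subsetP AV X XA; rewrite inE XV /=.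
apply: contraT => iX; have /drawsP[_ cX] := XV.
(* A member of [A] missing [i] would leave at least [s] points other than [i] outside it; adding [i]
   to [s] of these gives a member of [B] disjoint from it. *)
have /card_gt0P[Z /drawsP[ZX cZ]] : (0 < #|draws (~: X :\ i) s|)%N.
  rewrite card_draws bin_gt0; have := cardsD1 i (~: X); have := cardsC X.
  by rewrite cX cT inE iX; clear -ksN; lia.
have [ZX' iZ] : Z \subset ~: X /\ i \notin Z by apply/andP; rewrite -subsetD1.
have /(AB _ _ XA)/negP[] : i |: Z \in B.
  by rewrite BE inE setU11 andbT; apply/drawsP; rewrite subsetT cardsU1 iZ cZ.
by rewrite setI_eq0 disjoint_sym disjoints_subset subUset sub1set inE iX.
Qed.

(** * The theorem in its original parameters *)

(** Substituting [N - i] for [i] turns the sums of the second hypothesis into logarithmic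
    derivatives of binomial polynomials at [N], the form used by the product estimates. *)
Lemma sum_inv_rev (R : numFieldType) (N s : nat) : (s <= N.+1)%N ->
  \sum_((N.+1 - s)%N <= i < N.+1) 1 / i%:R =
    \sum_(0 <= i < s) (N%:R - i%:R)^-1 :> R.
Proof.
move=> sN; rewrite -{1}[(N.+1 - s)%N]add0n big_addn subKn // big_nat_rev.
apply: eq_big_nat => i /andP[_ lt_is]; rewrite div1r -natrB; last by lia.
by congr (_%:R^-1); lia.
Qed.

Lemma ksetsE (n k : nat) : ksets n k = draws setT k.
Proof. by apply/setP => X; rewrite !inE subsetT. Qed.

Lemma cross_intersectingP (n : nat) (A B : {set {set 'I_n}}) :
  reflect (forall X Y, X \in A -> Y \in B -> X :&: Y != set0)
    (cross_intersecting A B).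
Proof.
apply: (iffP forall_inP) => [AB X Y XA YB|AB X XA].
  by have /forall_inP/(_ Y YB) := AB X XA.
by apply/forall_inP => Y; apply: AB.
Qed.

Theorem theorem3 (n k l : nat)
  (hk : (0 < k)%N) (hl : n%:R / 2%:R < l%:R :> rat) (hkl : (k + l < n)%N)
  (h1 : (1 + (n%:R - k%:R) / (n%:R - 1)) * ((l%:R - 1) / (n%:R - 1)) < 1 :> rat)
  (h2 : (n%:R - k%:R) * (\sum_((n - l)%N <= i < (n - 2).+1) 1 / i%:R)
        - (n%:R - l%:R) * (\sum_(k <= i < (n - 2).+1) 1 / i%:R) < 0 :> rat) :
  M n k l = ('C(n - 1, k - 1) * 'C(n - 1, l - 1))%N /\
  (forall A B : {set {set 'I_n}},
     A \subset ksets n k -> B \subset ksets n l ->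
     cross_intersecting A B ->
     (#|A| * #|B|)%N = M n k l ->
     exists i : 'I_n,
       A = [set X in ksets n k | i \in X] /\
       B = [set Y in ksets n l | i \in Y]).
Proof.
move: hl; rewrite ltr_pdivrMr // -natrM ltr_nat => hl.
case: k => // k in hk hkl h1 h2 *; case: l => [|s] in hl hkl h1 h2 *; first by lia.
case: n => [|[|N]] in hl hkl h1 h2 *; [by lia | by lia |].
have ksN : (k + s < N)%N by lia.
have Ns : (N < s.*2)%N by lia.
have kN : (k <= N.+1)%N by lia.
have sN : (s <= N.+1)%N by lia.
have predE m : m.+1%:R - 1 = m%:R :> rat by rewrite -natr1 addrK.
have subE m : (m <= N.+1)%N -> N.+2%:R - m.+1%:R = (N.+1 - m)%:R :> rat.
  by move=> mN; rewrite -subSS natrB.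
have {}h1 : ((2 * N + 2 - k) * s < N.+1 ^ 2)%N.
  have -> : (2 * N + 2 - k = N.+1 + (N.+1 - k))%N by lia.
  move: h1; rewrite !predE subE // -(ltr_nat rat) natrM natrD natrX.
  have M0 : 0 < N.+1%:R :> rat by rewrite ltr0n.
  move: M0; move: N.+1%:R (N.+1 - k)%:R s%:R => M u t M0.
  have -> : (1 + u / M) * (t / M) = (M + u) * t / M ^+ 2.
    by field; apply: lt0r_neq0.
  by rewrite ltr_pdivrMr ?mul1r // exprn_gt0.
(* The rational inequality is transported to the real algebraic numbers, since [rbin_ivt] needs a
   real closed field. *)
have {}h2 : (N.+1 - k)%:R * \sum_(0 <= i < s) (N%:R - i%:R)^-1 <=
    (N.+1 - s)%:R * \sum_(0 <= i < N - k) (N%:R - i%:R)^-1 :> realalg.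
  have ratr_sum j : \sum_(0 <= i < j) (N%:R - i%:R)^-1 =
      ratr (\sum_(0 <= i < j) (N%:R - i%:R)^-1) :> realalg.
    by rewrite rmorph_sum; apply: eq_bigr => i _; rewrite fmorphV rmorphB !rmorph_nat.
  move: h2; rewrite !subE // subSS subn2 /= sum_inv_rev //.
  have -> : k.+1 = (N.+1 - (N - k))%N by lia.
  rewrite sum_inv_rev ?leqW ?leq_subr // subr_lt0 => /ltW.
  by rewrite -(ler_rat realalg) !rmorphM !rmorph_nat /= -!ratr_sum.
have star := cross_intersecting_star (card_ord N.+2) ksN Ns h1 h2.
rewrite !subn1 /= !ksetsE.
have ME : M N.+2 k.+1 s.+1 = ('C(N.+1, k) * 'C(N.+1, s))%N.
  apply/eqP; rewrite eqn_leq; apply/andP; split.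
    apply/bigmax_leqP => -[F G] /and3P[/=]; rewrite !ksetsE.
    by move=> FV GV /cross_intersectingP/(star _ _ FV GV)[].
  (* The bound is attained by the two full stars at [ord0]. *)
  pose full j := [set X in draws [set: 'I_N.+2] j.+1 | ord0 \in X].
  have card_full j : #|full j| = 'C(N.+1, j) by rewrite card_star card_ord.
  have full_sub j : full j \subset ksets N.+2 j.+1.
    by rewrite ksetsE; apply/subsetP => X; rewrite inE => /andP[].
  rewrite -!card_full; pose f (FG : {set {set 'I_N.+2}} * {set {set 'I_N.+2}}) :=
    (#|FG.1| * #|FG.2|)%N.
  apply: (@leq_bigmax_cond _ _ f (full k, full s)); rewrite /= !full_sub /=.
  apply/cross_intersectingP => X Y; rewrite !inE => /andP[_ X0] /andP[_ Y0].
  by apply/set0Pn; exists ord0; rewrite inE X0.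
split=> // A B AV BV /cross_intersectingP AB; rewrite ME.
by case: (star A B AV BV AB) => _; apply.
Qed.
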